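(* Let $n\ge1$ be an integer. The $\mathfrak{osp}(1|2n)$-action on $\mathbb{C}[x_1,\ldots,x_n]\otimes\mathbb{C}^{0|2n}$ obtained by conjugating the tensor product representation $\rho\otimes\tau$ on $\mathbb{C}[x_1,\ldots,x_n]\otimes\mathbb{C}^{1|2n}$ by ${}^{w_1}\Gamma$ and restricting, i.e. $X\cdot u=({}^{w_1}\Gamma)^{-1}\big((\rho\otimes\tau)(X)\,{}^{w_1}\Gamma(u)\big)$, is characterized by the following formulas, for $1\le i,j\le n$ and $k_1,\ldots,k_n\in\mathbb{Z}_{\ge0}$: $$X_j\big(x_1^{k_1}\cdots x_n^{k_n}\otimes v_i\big)=\frac1{\sqrt2}x_1^{k_1}\cdots x_j^{k_j+1}\cdots x_n^{k_n}\otimes v_i-\sqrt2\,x_1^{k_1}\cdots x_i^{k_i+1}\cdots x_n^{k_n}\otimes v_j,$$ $$X_j\big(x_1^{k_1}\cdots x_n^{k_n}\otimes v_{n+i}\big)=\frac1{\sqrt2}x_1^{k_1}\cdots x_j^{k_j+1}\cdots x_n^{k_n}\otimes v_{n+i}+\sqrt2\,k_i\,x_1^{k_1}\cdots x_i^{k_i-1}\cdots x_n^{k_n}\otimes v_j,$$ $$X_{-j}\big(x_1^{k_1}\cdots x_n^{k_n}\otimes v_i\big)=\frac1{\sqrt2}k_j\,x_1^{k_1}\cdots x_j^{k_j-1}\cdots x_n^{k_n}\otimes v_i+\sqrt2\,x_1^{k_1}\cdots x_i^{k_i+1}\cdots x_n^{k_n}\otimes v_{n+j},$$ $$X_{-j}\big(x_1^{k_1}\cdots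 x_n^{k_n}\otimes v_{n+i}\big)=\frac1{\sqrt2}k_j\,x_1^{k_1}\cdots x_j^{k_j-1}\cdots x_n^{k_n}\otimes v_{n+i}-\sqrt2\,k_i\,x_1^{k_1}\cdots x_i^{k_i-1}\cdots x_n^{k_n}\otimes v_{n+j}.$$
   Context: All vector spaces are over $\mathbb{C}$; $|\cdot|$ denotes parity in $\mathbb{Z}/2\mathbb{Z}$. A term with coefficient $k_i=0$ or $k_j=0$ is zero. $\mathbb{C}^{1|2n}$ has homogeneous basis $v_0$ (even), $v_1,\ldots,v_{2n}$ (odd); $\mathbb{C}^{0|2n}=\bigoplus_{i=1}^{2n}\mathbb{C}v_i$. The Lie superalgebra $\mathfrak{osp}(1|2n)\subset\mathfrak{gl}(1|2n)$ consists of the block matrices $\begin{bmatrix}0&r\\c&A\end{bmatrix}$ with $r=(r_1,\ldots,r_{2n})$, $c^{\intercal}=(r_{n+1},\ldots,r_{2n},-r_1,\ldots,-r_n)$, $A\in\mathfrak{sp}(2n)$, with the supercommutator bracket; $A$ gives the even part and $(r,c)$ the odd part. The inclusion is the natural representation $\tau$ on $\mathbb{C}^{1|2n}$. As a Lie superalgebra it is generated by the odd root vectors $X_{\pm j}$ ($1\le j\le n$), where $T_{\pm j}=\tau(X_{\pm j})$ acts by $T_jv_0=v_j$, $T_jv_{n+j}=v_0$, $T_{-j}v_0=-v_{n+j}$, $T_{-j}v_j=v_0$, and zero on all other basis vectors. The oscillator representation $\rho$ on $\mathbb{C}[x_1,\ldots,x_n]$ (parity of a monomial = its total degree mod 2)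 is determined by $\rho(X_j)=\tfrac1{\sqrt2}x_j$, $\rho(X_{-j})=\tfrac1{\sqrt2}\partial_{x_j}$. The tensor product representation $\rho\otimes\tau$ is $X(f\otimes v)=\rho(X)f\otimes v+(-1)^{|X||f|}f\otimes\tau(X)v$ for homogeneous $X,f$. The operator ${}^{w_1}\Gamma$ is the linear automorphism of $\mathbb{C}[x_1,\ldots,x_n]\otimes\mathbb{C}^{1|2n}$ $${}^{w_1}\Gamma=\mathbf{1}\otimes\mathbf{1}-\sqrt2\sum_{i=1}^n\partial_{x_i}\otimes T_i+\sqrt2\sum_{i=1}^nx_i\otimes T_{-i},$$ where, by the super sign rule, $(D\otimes T_{\pm i})(f\otimes v)=(-1)^{|f|}D(f)\otimes T_{\pm i}v$ for homogeneous $f$ and $D\in\{x_i,\partial_{x_i}\}$. It maps $\mathbb{C}[x_1,\ldots,x_n]\otimes\mathbb{C}^{0|2n}$ onto an $\mathfrak{osp}(1|2n)$-submodule. *)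

(* Defs.v *)
From HB Require Import structures.
From mathcomp Require Import all_boot all_order all_algebra.
From mathcomp Require Import reals.
From mathcomp Require Import complex.
From mathcomp Require Import mpoly.

Set Implicit Arguments.
Unset Strict Implicit.
Unset Printing Implicit Defensive.

Import Order.TTheory GRing.Theory Num.Theory.
Local Open Scope ring_scope.

Section OrthosymplecticAlgebra.
Variables (C : numClosedFieldType) (n : nat).

(* C^{1|2n} is 'cV[C]_(1 + (n + n)) and C^{0|2n} is 'cV[C]_(n + n); with 'I_n
   counting from 0, the vectors v_{j+1} and v_{n+j+1} are [odd_v j] and
   [odd_vn j] in C^{0|2n}, and [inc] is the inclusion in C^{1|2n}. *)
Definition odd_v (j : 'I_n) : 'cV[C]_(n + n) := delta_mx (lshift n j) 0.
Definition odd_vn (j : 'I_n) : 'cV[C]_(n + n) := delta_mx (rshift n j) 0.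
Definition inc (v : 'cV[C]_(n + n)) : 'cV[C]_(1 + (n + n)) := col_mx 0 v.
Definition v0 : 'cV[C]_(1 + (n + n)) := col_mx 1%:M 0.

Definition sympl_form : 'M[C]_(n + n) := block_mx 0 1%:M (- 1%:M) 0.

Definition sp (A : 'M[C]_(n + n)) : Prop :=
  A^T *m sympl_form + sympl_form *m A = 0.

Definition osp (X : 'M[C]_(1 + (n + n))) : Prop :=
  exists (r1 r2 : 'rV[C]_n) (A : 'M[C]_(n + n)),
    sp A /\ X = block_mx 0 (row_mx r1 r2) (row_mx r2 (- r1))^T A.

Definition even_part (X : 'M[C]_(1 + (n + n))) : 'M[C]_(1 + (n + n)) :=
  block_mx (ulsubmx X) 0 0 (drsubmx X).
Definition odd_part (X : 'M[C]_(1 + (n + n))) : 'M[C]_(1 + (n + n)) :=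
  block_mx 0 (ursubmx X) (dlsubmx X) 0.

(* Parities are booleans, with [true] for odd. *)
Definition mx_par (a : bool) (X : 'M[C]_(1 + (n + n))) : Prop :=
  X = if a then odd_part X else even_part X.

Definition superbracket (a b : bool) (X Y : 'M[C]_(1 + (n + n))) :
    'M[C]_(1 + (n + n)) :=
  X *m Y - (-1) ^+ (a && b) *: (Y *m X).

(* A representation of osp(1|2n) on the superspace V whose homogeneous vectors
   of parity a are given by [par a]; the values of phi outside osp(1|2n) are
   irrelevant. *)
Record is_rep (V : lmodType C) (par : bool -> V -> Prop)
    (phi : 'M[C]_(1 + (n + n)) -> V -> V) : Prop := IsRep {
  rep_linear : forall X, osp X -> forall (c : C) (u w : V),
    phi X (c *: u + w) = c *: phi X u + phi X w;
  rep_linear_osp : forall X Y, osp X -> osp Y -> forall (c : C) (u : V),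
    phi (c *: X + Y) u = c *: phi X u + phi Y u;
  rep_parity : forall a b X u, osp X -> mx_par a X -> par b u ->
    par (a (+) b) (phi X u);
  rep_bracket : forall a b X Y, osp X -> osp Y -> mx_par a X -> mx_par b Y ->
    forall u, phi (superbracket a b X Y) u
              = phi X (phi Y u) - (-1) ^+ (a && b) *: phi Y (phi X u)
}.

(* The odd generators X_j and X_{-j}, identified with T_j and T_{-j}. *)
Definition Xp (j : 'I_n) : 'M[C]_(1 + (n + n)) :=
  block_mx 0 (odd_vn j)^T (odd_v j) 0.
Definition Xm (j : 'I_n) : 'M[C]_(1 + (n + n)) :=
  block_mx 0 (odd_v j)^T (- odd_vn j) 0.

Definition poly_par (a : bool) (f : {mpoly C[n]}) : Prop :=
  forall m, m \in msupp f -> odd (mdeg m) = a.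

(* The linear map f |-> (-1)^{|f|} f. *)
Definition parity_sign (f : {mpoly C[n]}) : {mpoly C[n]} :=
  \sum_(m <- msupp f) ((-1) ^+ odd (mdeg m) * f@_m) *: 'X_[m].

Definition is_oscillator
    (rho : 'M[C]_(1 + (n + n)) -> {mpoly C[n]} -> {mpoly C[n]}) : Prop :=
  [/\ is_rep poly_par rho,
      forall j f, rho (Xp j) f = (sqrtC 2)^-1 *: ('X_j * f) &
      forall j f, rho (Xm j) f = (sqrtC 2)^-1 *: f^`M(j)].

(* C[x_1, ..., x_n] (x) C^m, as the free C[x_1, ..., x_n]-module on the standard
   basis of C^m; {ffun _ -> {mpoly _}} carries the C-linear structure. *)
Definition ptensor (m : nat) := {ffun 'I_m -> {mpoly C[n]}}.

Definition tens (m : nat) (f : {mpoly C[n]}) (v : 'cV[C]_m) : ptensor m :=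
  [ffun i => v i 0 *: f].

(* D (x) T for T homogeneous of parity b, with the super sign rule
   (D (x) T) (f (x) v) = (-1)^{b |f|} D f (x) T v. *)
Definition op_tens (m : nat) (b : bool) (D : {mpoly C[n]} -> {mpoly C[n]})
    (T : 'M[C]_m) (u : ptensor m) : ptensor m :=
  [ffun i => \sum_j T i j *: D (if b then parity_sign (u j) else u j)].


Definition tens_rep
    (rho : 'M[C]_(1 + (n + n)) -> {mpoly C[n]} -> {mpoly C[n]})
    (X : 'M[C]_(1 + (n + n))) (u : ptensor (1 + (n + n))) :
    ptensor (1 + (n + n)) :=
  op_tens false (rho X) 1%:M u
  + op_tens false id (even_part X) u + op_tens true id (odd_part X) u.

Definition Gamma (u : ptensor (1 + (n + n))) : ptensor (1 + (n + n)) :=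
  u - sqrtC 2 *: (\sum_(i < n) op_tens true (fun f => f^`M(i)) (Xp i) u)
    + sqrtC 2 *: (\sum_(i < n) op_tens true (fun f => 'X_i * f) (Xm i) u).

(* 1 (x) inc; see tincE. *)
Definition tinc (u : ptensor (n + n)) : ptensor (1 + (n + n)) :=
  [ffun i => if split i is inr k then u k else 0].

(* All vectors of C^{0|2n} are odd. *)
Definition odd_tens_par (a : bool) (u : ptensor (n + n)) : Prop :=
  forall i, poly_par (~~ a) (u i).

Definition action_formulas
    (act : 'M[C]_(1 + (n + n)) -> ptensor (n + n) -> ptensor (n + n)) : Prop :=
  forall (i j : 'I_n) (k : 'X_{1..n}),
  [/\ act (Xp j) (tens 'X_[k] (odd_v i))
      = (sqrtC 2)^-1 *: tens 'X_[k + U_(j)] (odd_v i)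
        - sqrtC 2 *: tens 'X_[k + U_(i)] (odd_v j),
      act (Xp j) (tens 'X_[k] (odd_vn i))
      = (sqrtC 2)^-1 *: tens 'X_[k + U_(j)] (odd_vn i)
        + (sqrtC 2 * (k i)%:R) *: tens 'X_[k - U_(i)] (odd_v j),
      act (Xm j) (tens 'X_[k] (odd_v i))
      = ((sqrtC 2)^-1 * (k j)%:R) *: tens 'X_[k - U_(j)] (odd_v i)
        + sqrtC 2 *: tens 'X_[k + U_(i)] (odd_vn j) &
      act (Xm j) (tens 'X_[k] (odd_vn i))
      = ((sqrtC 2)^-1 * (k j)%:R) *: tens 'X_[k - U_(j)] (odd_vn i)
        - (sqrtC 2 * (k i)%:R) *: tens 'X_[k - U_(i)] (odd_vn j)].

Lemma Xp_v0 j : Xp j *m v0 = inc (odd_v j).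
Proof. by rewrite mul_block_col !mul0mx mulmx0 mulmx1 !addr0. Qed.

Lemma Xm_v0 j : Xm j *m v0 = - inc (odd_vn j).
Proof.
by rewrite mul_block_col !mul0mx mulmx0 mulmx1 !addr0 -[RHS]scaleN1r
  scale_col_mx scaler0 scaleN1r.
Qed.

Lemma delta_tr_mul m (i j : 'I_m) :
  (delta_mx i 0 : 'cV[C]_m)^T *m (delta_mx j 0 : 'cV[C]_m) = ((i == j)%:R)%:M.
Proof.
rewrite trmx_delta mul_delta_mx_cond; apply/matrixP=> a b.
by rewrite !ord1; case: eqP => _; rewrite ?mulr1n ?mulr0n !mxE.
Qed.

Lemma Xp_odd_vn i j : Xp j *m inc (odd_vn i) = (j == i)%:R *: v0.
Proof.
rewrite mul_block_col !mul0mx mulmx0 add0r addr0 delta_tr_mul.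
by rewrite eq_rshift scale_col_mx scaler0 scalemx1.
Qed.

Lemma Xp_odd_v i j : Xp j *m inc (odd_v i) = 0.
Proof. by rewrite mul_block_col !mul0mx mulmx0 !addr0 add0r delta_tr_mul eq_rlshift raddf0 col_mx0. Qed.

Lemma Xm_odd_v i j : Xm j *m inc (odd_v i) = (j == i)%:R *: v0.
Proof.
rewrite mul_block_col !mul0mx mulmx0 add0r addr0 delta_tr_mul.
by rewrite eq_lshift scale_col_mx scaler0 scalemx1.
Qed.

Lemma Xm_odd_vn i j : Xm j *m inc (odd_vn i) = 0.
Proof. by rewrite mul_block_col !mul0mx mulmx0 !addr0 add0r delta_tr_mul eq_lrshift raddf0 col_mx0. Qed.

Lemma parity_sign_hom a f : poly_par a f -> parity_sign f = (-1) ^+ a *: f.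
Proof.
move=> fa; rewrite [in RHS](mpolyE f) scaler_sumr; apply: eq_big_seq => m mf.
by rewrite (fa _ mf) scalerA.
Qed.

Lemma op_tensE m (D : {linear {mpoly C[n]} -> {mpoly C[n]}}) (T : 'M[C]_m)
    a b f (v : 'cV[C]_m) : poly_par a f ->
  op_tens b D T (tens f v) = (-1) ^+ (b && a) *: tens (D f) (T *m v).
Proof.
move=> fa; apply/ffunP=> i; rewrite !ffunE mxE scaler_suml scaler_sumr.
apply: eq_bigr => j _; rewrite ffunE.
have vfa : poly_par a (v j 0 *: f) by move=> k /msuppZ_le /fa.
case: b; rewrite ?(parity_sign_hom vfa) /= !linearZ /= ?scale1r !scalerA //.
  by congr (_ *: _); rewrite mulrC mulrA mulrAC.
by rewrite mulrC.
Qed.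

Lemma tincE f (v : 'cV[C]_(n + n)) : tinc (tens f v) = tens f (inc v).
Proof.
by apply/ffunP=> i; rewrite !ffunE mxE; case: split => k;
  rewrite ?ffunE // mxE scale0r.
Qed.

Lemma osp_Xp j : osp (Xp j).
Proof.
exists 0, (delta_mx 0 j), 0; split.
  by rewrite /sp trmx0 mul0mx mulmx0 addr0.
rewrite /Xp /odd_v /odd_vn oppr0 tr_row_mx trmx0 trmx_delta trmx_delta.
congr block_mx; apply/matrixP=> a b; rewrite !mxE !ord1;
  case: splitP => k ak; rewrite !mxE -?val_eqE /= ?ak ?eqn_add2l ?andbT //.
  by rewrite ltn_eqF // (leq_trans (ltn_ord k)) ?leq_addr.
by rewrite gtn_eqF // (leq_trans (ltn_ord j)) ?leq_addr.
Qed.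

Lemma osp_Xm j : osp (Xm j).
Proof.
exists (delta_mx 0 j), 0, 0; split.
  by rewrite /sp trmx0 mul0mx mulmx0 addr0.
rewrite /Xm /odd_v /odd_vn tr_row_mx trmx0 linearN /= !trmx_delta.
congr block_mx; apply/matrixP=> a b; rewrite !mxE !ord1;
  case: splitP => k ak; rewrite !mxE -?val_eqE /= ?ak ?eqn_add2l ?andbT //.
  by rewrite gtn_eqF // (leq_trans (ltn_ord j)) ?leq_addr.
by rewrite ltn_eqF ?oppr0 // (leq_trans (ltn_ord k)) ?leq_addr.
Qed.

End OrthosymplecticAlgebra.

(* Main.v *)
Require Import Defs.
From HB Require Import structures.
From mathcomp Require Import all_boot all_order all_algebra.
From mathcomp Require Import reals.
From mathcomp Require Import complex.
From mathcomp Require Import mpoly.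
From mathcomp Require Import ring.
Import Order.TTheory GRing.Theory Num.Theory.
Local Open Scope ring_scope.

(** Write s = sqrt 2, sigma f = (-1)^{|f|} f and
    E u = s * sum_i (x_i sigma u_i - d_i sigma u_{n+i}).  The image under Gamma
    of the polynomials with values in C^{0|2n} is the graph w_0 = E w of E, so
    that the transported action of X on u is the odd part of
    (rho (x) tau)(X) (E u, u), and inverting Gamma amounts to inverting
    w_0 |-> (1 + 2n) w_0.  The functional K w = w_0 - E w satisfies
    K X_j = - s^-1 x_j K and K X_{-j} = - s^-1 d_j K; hence ker K is stable
    under the generators, and under osp(1|2n), which is linearly spanned by
    the generators and their anticommutators. *)

(** * The parity involution sigma on polynomials *)

Section ParitySign.
Context {C : numClosedFieldType} {n : nat}.
Implicit Types (f g : {mpoly C[n]}) (a b : bool).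

(** The defining sum of [parity_sign] runs over a support that varies with f; its coefficients do
    not depend on that support, and linearity follows from them. *)
Lemma mcoeff_parity_sign f m :
  (parity_sign f)@_m = (-1) ^+ odd (mdeg m) * f@_m.
Proof.
rewrite /parity_sign raddf_sum /=.
have [mf|mNf] := boolP (m \in msupp f).
  rewrite (bigD1_seq m) ?msupp_uniq //= big1 => [|k km].
    by rewrite mcoeffZ mcoeffX eqxx mulr1 addr0.
  by rewrite mcoeffZ mcoeffX (negPf km) mulr0.
rewrite (memN_msupp_eq0 mNf) mulr0 big_seq big1 // => k kf.
rewrite mcoeffZ mcoeffX; case: eqP => [km|]; last by rewrite mulr0.
by rewrite -km kf in mNf.
Qed.

Fact parity_sign_is_linear : linear (@parity_sign C n).
Proof.
move=> c f g; apply/mpolyP=> m.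
by rewrite mcoeffD mcoeffZ !mcoeff_parity_sign mcoeffD mcoeffZ mulrDr mulrCA.
Qed.
HB.instance Definition _ :=
  GRing.isLinear.Build C _ _ _ (@parity_sign C n) parity_sign_is_linear.

Lemma parity_signK : involutive (@parity_sign C n).
Proof. by move=> f; apply/mpolyP=> m; rewrite !mcoeff_parity_sign signrMK. Qed.

Lemma poly_parX m : poly_par (odd (mdeg m)) ('X_[m] : {mpoly C[n]}).
Proof. by move=> k; rewrite msuppX inE => /eqP->. Qed.

Lemma poly_par0 a : poly_par a (0 : {mpoly C[n]}).
Proof. by move=> k; rewrite msupp0. Qed.

Lemma poly_parD a f g : poly_par a f -> poly_par a g -> poly_par a (f + g).
Proof. by move=> fa ga k /msuppD_le; rewrite mem_cat => /orP[/fa|/ga]. Qed.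

Lemma poly_parZ a c f : poly_par a f -> poly_par a (c *: f).
Proof. by move=> fa k /msuppZ_le /fa. Qed.

Lemma poly_par_sum (I : eqType) (r : seq I) (F : I -> {mpoly C[n]}) a :
  (forall i, i \in r -> poly_par a (F i)) -> poly_par a (\sum_(i <- r) F i).
Proof.
move=> Fa; rewrite big_seq; apply: (@big_ind _ (poly_par a)).
- exact: poly_par0.
- exact: poly_parD.
- exact: Fa.
Qed.

Lemma poly_par_sign a f : poly_par a f -> poly_par a (parity_sign f).
Proof. by move=> fa; rewrite (parity_sign_hom fa); apply: poly_parZ. Qed.

Lemma eq_linear_mpoly (V : lmodType C) (D E : {linear {mpoly C[n]} -> V}) :
  (forall m, D 'X_[m] = E 'X_[m]) -> D =1 E.
Proof.
move=> DE f; rewrite (mpolyE f) !linear_sum; apply: eq_bigr => m _.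
by rewrite !linearZ /= DE.
Qed.

(** Both sides are linear in f, so monomials suffice; these are homogeneous, and on them sigma is a
    scalar. *)
Lemma linear_parity_sign (D : {linear {mpoly C[n]} -> {mpoly C[n]}}) a :
  (forall b f, poly_par b f -> poly_par (a (+) b) (D f)) ->
  forall f, D (parity_sign f) = (-1) ^+ a *: parity_sign (D f).
Proof.
move=> Da f.
pose L : {linear {mpoly C[n]} -> {mpoly C[n]}} := D \o @parity_sign C n.
pose E : {linear {mpoly C[n]} -> {mpoly C[n]}} :=
  (-1) ^+ a \*: (@parity_sign C n \o D).
suff: L f = E f by [].
apply: eq_linear_mpoly => m; rewrite /L /E /=.
have mp := poly_parX m.
rewrite (parity_sign_hom mp) (parity_sign_hom (Da _ _ mp)) linearZ /=.
by rewrite scalerA signr_addb mulrA -expr2 sqrr_sign mul1r.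
Qed.

(** The sign picked up when an operator of parity a passes f, so that even and odd elements share
    one formula for the tensor action. *)
Definition sgn_if a f := if a then parity_sign f else f.

Fact sgn_if_is_linear a : linear (sgn_if a).
Proof. by case: a => c f g //=; rewrite linearP. Qed.
HB.instance Definition _ a :=
  GRing.isLinear.Build C _ _ _ (sgn_if a) (sgn_if_is_linear a).

Lemma sgn_ifD a b f : sgn_if a (sgn_if b f) = sgn_if (a (+) b) f.
Proof. by case: a b => [] [] //=; rewrite parity_signK. Qed.

Lemma linear_sgn_if (D : {linear {mpoly C[n]} -> {mpoly C[n]}}) a b :
  (forall b' f, poly_par b' f -> poly_par (a (+) b') (D f)) ->
  forall f, D (sgn_if b f) = (-1) ^+ (a && b) *: sgn_if b (D f).
Proof.
move=> Da f; case: b => /=; last by rewrite andbF scale1r.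
by rewrite andbT; apply: linear_parity_sign.
Qed.

End ParitySign.

(** Representations are bare functions whose linearity is a hypothesis; this bundles them so that
    the generic theory of linear maps applies. *)
Lemma linear_structure (C : nzRingType) (U V : lmodType C) (phi : U -> V) :
  linear phi -> exists D : {linear U -> V}, phi = D.
Proof.
move=> lphi; pose i := GRing.isLinear.Build C U V *:%R phi lphi.
by exists (HB.pack_for {linear U -> V} phi i).
Qed.

(** * Structure of osp(1|2n) and its generation by the odd root vectors *)

Section Osp.
Context {C : numClosedFieldType} {n : nat}.
Local Notation M := 'M[C]_(1 + (n + n)).
Implicit Types (X Y : M) (a b : bool) (j : 'I_n).

Fact even_part_is_linear : linear (@even_part C n).
Proof.
move=> c X Y; rewrite /even_part scale_block_mx add_block_mx !scaler0 !addr0.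
by congr block_mx; apply/matrixP=> i j; rewrite !mxE.
Qed.
HB.instance Definition _ :=
  GRing.isLinear.Build C _ _ _ (@even_part C n) even_part_is_linear.

Fact odd_part_is_linear : linear (@odd_part C n).
Proof.
move=> c X Y; rewrite /odd_part scale_block_mx add_block_mx !scaler0 !addr0.
by congr block_mx; apply/matrixP=> i j; rewrite !mxE.
Qed.
HB.instance Definition _ :=
  GRing.isLinear.Build C _ _ _ (@odd_part C n) odd_part_is_linear.

Lemma mx_par_lin a c X Y : mx_par a X -> mx_par a Y -> mx_par a (c *: X + Y).
Proof. by case: a; rewrite /mx_par linearP /= => <- <-. Qed.

Lemma mx_par_mul a b X Y :
  mx_par a X -> mx_par b Y -> mx_par (a (+) b) (X *m Y).
Proof.
by case: a b => [] [] /= -> ->;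
  rewrite /mx_par /= /even_part /odd_part mulmx_block
    !(mulmx0, mul0mx, addr0, add0r)
    ?(block_mxKul, block_mxKur, block_mxKdl, block_mxKdr).
Qed.

Lemma mx_par_superbracket a b X Y :
  mx_par a X -> mx_par b Y -> mx_par (a (+) b) (superbracket a b X Y).
Proof.
move=> Xa Yb; rewrite /superbracket addrC -scaleNr.
by apply: mx_par_lin; [rewrite addbC|]; apply: mx_par_mul.
Qed.

Lemma even_part_par a X : mx_par a X -> even_part X = if a then 0 else X.
Proof.
case: a => // ->; rewrite /even_part /odd_part block_mxKul block_mxKdr.
exact: block_mx0.
Qed.

Lemma odd_part_par a X : mx_par a X -> odd_part X = if a then X else 0.
Proof.
case: a => // ->; rewrite /even_part /odd_part block_mxKur block_mxKdl.
exact: block_mx0.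
Qed.

(** Linear coordinates on osp(1|2n). With J the symplectic form, the column attached to r is J r^T,
    and sp(2n) consists of the products J S with S symmetric. *)
Definition odd_elt (r : 'rV[C]_(n + n)) : M :=
  block_mx 0 r (sympl_form C n *m r^T) 0.
Definition even_elt (S : 'M[C]_(n + n)) : M :=
  block_mx 0 0 0 (sympl_form C n *m S).

Lemma odd_elt_is_linear : linear odd_elt.
Proof.
move=> c r s; rewrite /odd_elt scale_block_mx add_block_mx !scaler0 !addr0.
by rewrite linearP /= linearP.
Qed.
HB.instance Definition _ :=
  GRing.isLinear.Build C _ _ _ odd_elt odd_elt_is_linear.

Lemma even_elt_is_linear : linear even_elt.
Proof.
move=> c S T; rewrite /even_elt scale_block_mx add_block_mx !scaler0 !addr0.
by rewrite linearP.
Qed.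
HB.instance Definition _ :=
  GRing.isLinear.Build C _ _ _ even_elt even_elt_is_linear.

Lemma tr_sympl_form : (sympl_form C n)^T = - sympl_form C n.
Proof.
by rewrite tr_block_mx opp_block_mx !linearN /= !trmx0 trmx1 !oppr0 opprK.
Qed.

Lemma sympl_form_sqr : sympl_form C n *m sympl_form C n = - 1%:M.
Proof.
rewrite mulmx_block !mulmx0 !mul0mx !mulmx1 mul1mx !addr0 !add0r.
by rewrite (scalar_mx_block n n) opp_block_mx !oppr0.
Qed.

Lemma sympl_form_tr_row (r : 'rV[C]_(n + n)) :
  sympl_form C n *m r^T = (row_mx (rsubmx r) (- lsubmx r))^T.
Proof.
rewrite -{1}(hsubmxK r) !tr_row_mx mul_block_col !mul0mx !mul1mx mulNmx.
by rewrite mul1mx add0r addr0 linearN.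
Qed.

(** Since J^2 = -1, the equation A = J S forces S = - J A; since J^T = - J, this S is symmetric
    exactly when A^T J + J A = 0. *)
Lemma ospP X : osp X <->
  exists (r : 'rV[C]_(n + n)) S, S^T = S /\ X = odd_elt r + even_elt S.
Proof.
split=> [[r1 [r2 [A [Asp ->]]]]|[r [S [Ssym ->]]]].
  exists (row_mx r1 r2), (- sympl_form C n *m A); split.
    rewrite trmx_mul linearN /= tr_sympl_form opprK mulNmx.
    by apply/eqP; rewrite -addr_eq0; apply/eqP.
  rewrite /odd_elt /even_elt sympl_form_tr_row row_mxKl row_mxKr add_block_mx.
  by rewrite !addr0 !add0r mulmxA mulmxN sympl_form_sqr opprK mul1mx.
exists (lsubmx r), (rsubmx r), (sympl_form C n *m S); split.
  rewrite /sp trmx_mul Ssym tr_sympl_form mulmxN mulNmx -mulmxA.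
  by rewrite mulmxA -mulmxA sympl_form_sqr mulmxA sympl_form_sqr mulmxN mulNmx
     mulmx1 mul1mx opprK subrr.
by rewrite /odd_elt /even_elt sympl_form_tr_row hsubmxK add_block_mx !addr0
  !add0r.
Qed.

Lemma osp_lin c X Y : osp X -> osp Y -> osp (c *: X + Y).
Proof.
move=> /ospP[r [S [Ss ->]]] /ospP[r' [S' [Ss' ->]]]; apply/ospP.
exists (c *: r + r'), (c *: S + S'); split; first by rewrite linearP /= Ss Ss'.
by rewrite !linearP /= scalerDr addrACA.
Qed.

Lemma osp_odd_elt r : osp (odd_elt r).
Proof. by apply/ospP; exists r, 0; rewrite trmx0 linear0 addr0. Qed.

Lemma osp_even_elt S : S^T = S -> osp (even_elt S).
Proof. by move=> Ss; apply/ospP; exists 0, S; rewrite linear0 add0r. Qed.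

Lemma osp0 : osp (0 : M).
Proof. by rewrite -(linear0 odd_elt); apply: osp_odd_elt. Qed.

Lemma mx_par_odd_elt r : mx_par true (odd_elt r).
Proof. by rewrite /mx_par /odd_part /odd_elt block_mxKur block_mxKdl. Qed.

(** The upper left entry r J s^T + s J r^T vanishes: a 1 by 1 matrix equals its transpose, and J is
    antisymmetric. *)
Lemma superbracket_odd_elt (r s : 'rV[C]_(n + n)) :
  superbracket true true (odd_elt r) (odd_elt s)
  = even_elt (r^T *m s + s^T *m r).
Proof.
rewrite /superbracket /= expr1 scaleN1r opprK !mulmx_block add_block_mx.
rewrite !mulmx0 !mul0mx !addr0 !add0r /even_elt mulmxDr !mulmxA; congr block_mx.
have tr1 (A : 'M[C]_1) : A^T = A by apply/matrixP=> i j; rewrite mxE !ord1.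
rewrite -[X in X + _]tr1 !trmx_mul trmxK tr_sympl_form mulNmx mulmxN.
by rewrite mulmxA addNr.
Qed.

Lemma XpE j : Xp C j = odd_elt (delta_mx 0 (rshift n j)).
Proof.
rewrite /Xp /odd_elt sympl_form_tr_row /odd_v /odd_vn trmx_delta.
congr block_mx; apply/matrixP=> i k; rewrite !mxE.
by case: split_ordP => l ->; rewrite !mxE !ord1 ?eq_lshift ?eq_rshift
  ?eq_rlshift ?eq_lrshift ?oppr0 /= ?andbT.
Qed.

Lemma XmE j : Xm C j = odd_elt (delta_mx 0 (lshift n j)).
Proof.
rewrite /Xm /odd_elt sympl_form_tr_row /odd_v /odd_vn trmx_delta.
congr block_mx; apply/matrixP=> i k; rewrite !mxE.
by case: split_ordP => l ->; rewrite !mxE !ord1 ?eq_lshift ?eq_rshift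
  ?eq_rlshift ?eq_lrshift ?oppr0 /= ?andbT.
Qed.

Lemma mx_par_Xp j : mx_par true (Xp C j).
Proof. by rewrite XpE; apply: mx_par_odd_elt. Qed.

Lemma mx_par_Xm j : mx_par true (Xm C j).
Proof. by rewrite XmE; apply: mx_par_odd_elt. Qed.

(* Symmetric matrices are spanned by the [e_a^T e_b + e_b^T e_a], so the even
   part of osp(1|2n) is spanned by anticommutators of the generators. *)
Lemma osp_ind (P : M -> Prop) :
  P 0 ->
  (forall c X Y, osp X -> osp Y -> P X -> P Y -> P (c *: X + Y)) ->
  (forall j, P (Xp C j)) -> (forall j, P (Xm C j)) ->
  (forall X Y, osp X -> osp Y -> mx_par true X -> mx_par true Y ->
     P X -> P Y -> P (superbracket true true X Y)) ->
  forall X, osp X -> P X.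
Proof.
move=> P0 Plin Pp Pm Pbr X Xosp.
pose Q Y := osp Y /\ P Y.
have Qsum (I : finType) (c : I -> C) F :
    (forall i, Q (F i)) -> Q (\sum_i c i *: F i).
  move=> QF; elim/big_rec: _ => [|i Y _ [Yo YP]];
    first by split; [exact: osp0|].
  by have [Fo FP] := QF i; split; [apply: osp_lin|apply: Plin].
have Qe (a : 'I_(n + n)) : Q (odd_elt (delta_mx 0 a)).
  split; first exact: osp_odd_elt.
  by case: (split_ordP a) => i ->; rewrite -?XpE -?XmE.
have Qs (a b : 'I_(n + n)) : Q (even_elt (delta_mx a b + delta_mx b a)).
  split.
    by apply: osp_even_elt; rewrite linearD /= !trmx_delta addrC.
  have [[ao aP] [bo bP]] := (Qe a, Qe b).
  have := Pbr _ _ ao bo (mx_par_odd_elt _) (mx_par_odd_elt _) aP bP.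
  by rewrite superbracket_odd_elt !trmx_delta !mul_delta_mx.
have [r [S [Ssym XE]]] := (ospP X).1 Xosp.
have rE : odd_elt r = \sum_a r 0 a *: odd_elt (delta_mx 0 a).
  by rewrite {1}[r]row_sum_delta linear_sum; apply: eq_bigr => a _;
    rewrite linearZ.
(* The factor 1/2 comes from S = (S + S^T) / 2, expanded entrywise. *)
have SE : even_elt S = \sum_a 2^-1 *:
    \sum_b S a b *: even_elt (delta_mx a b + delta_mx b a).
  transitivity (even_elt (2^-1 *: (S + S^T))).
    rewrite Ssym -mulr2n -[S *+ 2]scaler_nat scalerA mulVf ?pnatr_eq0 //.
    by rewrite scale1r.
  rewrite linearZ /= -scaler_sumr; congr (_ *: _).
  rewrite {1 2}(matrix_sum_delta S) [_^T]linear_sum -big_split linear_sum.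
  apply: eq_bigr => a _ /=; rewrite linear_sum -big_split linear_sum.
  apply: eq_bigr => b _ /=; rewrite [(_ *: _)^T]linearZ /= trmx_delta.
  by rewrite -scalerDr linearZ.
have Qr : Q (odd_elt r) by rewrite rE; apply: Qsum.
have QS : Q (even_elt S).
  by rewrite SE; apply: (Qsum) => a; apply: (Qsum) => b; apply: Qs.
rewrite XE -[odd_elt r]scale1r.
by case: Qr QS => ro rP [So SP]; apply: Plin.
Qed.

End Osp.

(** * Coordinates on the tensor product, and the operator Gamma with its inverse *)

Section TensorAction.
Context {C : numClosedFieldType} {n : nat}.
Local Notation M := 'M[C]_(1 + (n + n)).
Local Notation P := {mpoly C[n]}.
Local Notation i0 := (lshift (n + n) (ord0 : 'I_1)).
Local Notation iodd := (@rshift 1 (n + n)).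
Local Notation s2 := (sqrtC 2 : C).

Lemma sqrt2_sqr : s2 * s2 = 2.
Proof. by rewrite -expr2 sqrtCK. Qed.

Lemma sqrt2_neq0 : s2 != 0.
Proof. by rewrite sqrtC_eq0 pnatr_eq0. Qed.

(** * Rows of the odd generators applied to a family of coordinates *)

Section OddBlock.
Variables (V : lmodType C) (F : 'I_(1 + (n + n)) -> V).

Lemma sum_odd_block0 (r : 'rV[C]_(n + n)) c :
  \sum_j block_mx 0 r c 0 i0 j *: F j = \sum_a r 0 a *: F (iodd a).
Proof.
rewrite big_split_ord /= big_ord1 block_mxEul mxE scale0r add0r.
by apply: eq_bigr => a _; rewrite block_mxEur.
Qed.

Lemma sum_odd_block (r : 'rV[C]_(n + n)) c a :
  \sum_j block_mx 0 r c 0 (iodd a) j *: F j = c a 0 *: F i0.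
Proof.
rewrite big_split_ord /= big_ord1 block_mxEdl big1 ?addr0 // => b _.
by rewrite block_mxEdr mxE scale0r.
Qed.

Lemma sum_Xp0 j : \sum_k Xp C j i0 k *: F k = F (iodd (rshift n j)).
Proof.
rewrite sum_odd_block0 (bigD1 (rshift n j)) //= big1 => [|a aj].
  by rewrite !mxE !eqxx scale1r addr0.
by rewrite !mxE (negPf aj) scale0r.
Qed.

Lemma sum_Xm0 j : \sum_k Xm C j i0 k *: F k = F (iodd (lshift n j)).
Proof.
rewrite sum_odd_block0 (bigD1 (lshift n j)) //= big1 => [|a aj].
  by rewrite !mxE !eqxx scale1r addr0.
by rewrite !mxE (negPf aj) scale0r.
Qed.

Lemma sum_Xp j a :
  \sum_k Xp C j (iodd a) k *: F k = (a == lshift n j)%:R *: F i0.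
Proof. by rewrite sum_odd_block !mxE !ord1 eqxx andbT. Qed.

Lemma sum_Xm j a :
  \sum_k Xm C j (iodd a) k *: F k = - (a == rshift n j)%:R *: F i0.
Proof. by rewrite sum_odd_block !mxE !ord1 eqxx andbT. Qed.

End OddBlock.

(** * Multiplication and differentiation by a variable, and their signs *)

Definition mulX (j : 'I_n) (f : P) : P := 'X_j * f.
Fact mulX_is_linear j : linear (mulX j).
Proof. by move=> c f g; rewrite /mulX mulrDr scalerAr. Qed.
HB.instance Definition _ j :=
  GRing.isLinear.Build C _ _ _ (mulX j) (mulX_is_linear j).

Lemma mulX_par j b f : poly_par b f -> poly_par (~~ b) (mulX j f).
Proof.
move=> fb; rewrite /mulX (mpolyE f) mulr_sumr.
apply: poly_par_sum => m mf.
rewrite -scalerAr -mpolyXD; apply: poly_parZ.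
by rewrite -(fb m mf) -[~~ _]/(odd (1 + mdeg m)) -(mdeg1 j) -mdegD;
  apply: poly_parX.
Qed.

Lemma mderiv_par j b f : poly_par b f -> poly_par (~~ b) (f^`M(j) : P).
Proof.
move=> fb; rewrite (mpolyE f) linear_sum /=.
apply: poly_par_sum => m mf.
(* If m j = 0, the truncated difference m - U_(j) is m itself, which has the wrong parity; the zero
   coefficient has to be used instead. *)
rewrite linearZ /= mderivX; apply: poly_parZ; have [mj0|mj] := posnP (m j).
  by rewrite mj0 scale0r; apply: poly_par0.
apply: poly_parZ.
have /submK mE : (U_(j) <= m)%MM by rewrite lep1mP -lt0n.
rewrite -(fb m mf) -{1}mE mdegD mdeg1 addn1 /= negbK; exact: poly_parX.
Qed.

(** Operators that reverse parity anticommute with sigma; the same holds for derivatives in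
    [mderiv_sign]. *)
Lemma mulX_sign j f : mulX j (parity_sign f) = - parity_sign (mulX j f).
Proof.
rewrite -scaleN1r -[-1]expr1.
by apply: (linear_parity_sign (mulX j) true) => b g; apply: mulX_par.
Qed.

Lemma mderiv_sign j f : (parity_sign f)^`M(j) = - parity_sign (f^`M(j)) :> P.
Proof.
rewrite -scaleN1r -[-1]expr1.
by apply: (linear_parity_sign (mderiv j) true) => b g; apply: mderiv_par.
Qed.

Lemma sign_mulX_sign j f :
  parity_sign (mulX j (parity_sign f)) = - mulX j f.
Proof. by rewrite mulX_sign linearN /= parity_signK. Qed.

Lemma sign_mderiv_sign j f :
  parity_sign ((parity_sign f)^`M(j)) = - f^`M(j) :> P.
Proof. by rewrite mderiv_sign linearN /= parity_signK. Qed.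

(** The canonical commutation relation of the Weyl algebra. *)
Lemma mderiv_mulX i j f :
  (mulX j f)^`M(i) = (i == j)%:R *: f + mulX j (f^`M(i)) :> P.
Proof.
rewrite /mulX mderivM; congr (_ + _); rewrite mderivX -scalerAl.
rewrite mnm1E eq_sym; case: eqP => [->|_]; last by rewrite !scale0r.
by rewrite -[X in (X - _)%MM]add0m addmK mpolyX0 !scale1r mul1r.
Qed.

(** * The graph of E and the inversion of Gamma *)

Local Notation V := (ptensor C n (1 + (n + n))).
Local Notation U := (ptensor C n (n + n)).
Implicit Types (u : U) (w : V).

Definition odd_comp w : U := [ffun a => w (iodd a)].

(* The even component which makes [w] lie in the image of C^{0|2n} under
   Gamma, as a function of its odd components. *)
Definition even_comp u : P :=
  s2 *: \sum_(i < n) (mulX i (parity_sign (u (lshift n i)))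
                      - (parity_sign (u (rshift n i)))^`M(i)).

(** The functional K, with [even_comp] as E. Its kernel is the image under Gamma of the polynomials
    with values in C^{0|2n}, by [defect0_Gamma] and [defect_Gamma]. *)
Definition defect w : P := w i0 - even_comp (odd_comp w).

Definition glue (f : P) u : V :=
  [ffun r => if split r is inr a then u a else f].

Lemma glue0 f u : glue f u i0 = f.
Proof. by rewrite ffunE -[i0]/(unsplit (inl _)) unsplitK. Qed.

Lemma glue_odd f u a : glue f u (iodd a) = u a.
Proof. by rewrite ffunE -[iodd a]/(unsplit (inr _)) unsplitK. Qed.

Lemma eq_ptensor w w' :
  w i0 = w' i0 -> (forall a, w (iodd a) = w' (iodd a)) -> w = w'.
Proof.
move=> w0 wo; apply/ffunP=> r.
by case: (split_ordP r) => k ->; rewrite ?ord1.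
Qed.

Fact odd_comp_is_linear : linear odd_comp.
Proof. by move=> c u v; apply/ffunP=> a; rewrite !ffunE. Qed.
HB.instance Definition _ :=
  GRing.isLinear.Build C V U _ odd_comp odd_comp_is_linear.

Fact even_comp_is_linear : linear even_comp.
Proof.
move=> c u v; rewrite /even_comp scalerA mulrC -scalerA -scalerDr.
congr (_ *: _); rewrite scaler_sumr -big_split; apply: eq_bigr => i _ /=.
by rewrite !ffunE !linearP /= scalerDr addrACA.
Qed.
HB.instance Definition _ :=
  GRing.isLinear.Build C U P _ even_comp even_comp_is_linear.

Fact defect_is_linear : linear defect.
Proof.
by move=> c u v; rewrite /defect !linearP /= !ffunE scalerDr addrACA.
Qed.
HB.instance Definition _ :=
  GRing.isLinear.Build C V P _ defect defect_is_linear.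

(** The generators feed E u into the odd components only through sigma (E u). The two signs cancel
    here, which is why the final formulas contain no parity sign. *)
Lemma parity_sign_even_comp u :
  parity_sign (even_comp u) =
  s2 *: \sum_(i < n) ((u (rshift n i))^`M(i) - mulX i (u (lshift n i))).
Proof.
rewrite /even_comp linearZ linear_sum /=; congr (_ *: _).
apply: eq_bigr => i _.
by rewrite linearB /= sign_mulX_sign sign_mderiv_sign opprK addrC.
Qed.

Lemma even_comp_par b u : odd_tens_par b u -> poly_par b (even_comp u).
Proof.
move=> ub; apply: poly_parZ; apply: poly_par_sum => i _; apply: poly_parD.
  by rewrite -[b]negbK; apply: mulX_par; apply: poly_par_sign.
rewrite -scaleN1r -[b]negbK; apply: poly_parZ; apply: mderiv_par.
exact: poly_par_sign.
Qed.

(** Up to the factor - s, this is what Gamma adds to the odd components when the even one is f: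
    Gamma sends (f, u) to (f + E u, u - s [corr] f). *)
Definition corr (f : P) : U :=
  [ffun a => match split a with
             | inl i => (parity_sign f)^`M(i)
             | inr i => mulX i (parity_sign f)
             end].

Lemma corr_l f i : corr f (lshift n i) = (parity_sign f)^`M(i).
Proof. by rewrite ffunE -[lshift n i]/(unsplit (inl _)) unsplitK. Qed.

Lemma corr_r f i : corr f (rshift n i) = mulX i (parity_sign f).
Proof. by rewrite ffunE -[rshift n i]/(unsplit (inr _)) unsplitK. Qed.

Fact corr_is_linear : linear corr.
Proof.
move=> c f g; apply/ffunP=> a; rewrite !ffunE.
by case: split => i; rewrite !linearP.
Qed.
HB.instance Definition _ :=
  GRing.isLinear.Build C P U _ corr corr_is_linear.

(** Each index i contributes d_i x_i f - x_i d_i f = f, whence the factor n. *)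
Lemma even_comp_corr f : even_comp (corr f) = (s2 * n%:R) *: f.
Proof.
rewrite /even_comp -scalerA; congr (_ *: _).
rewrite (eq_bigr (fun=> f)) => [|i _].
  by rewrite sumr_const card_ord scaler_nat.
rewrite corr_l corr_r sign_mulX_sign sign_mderiv_sign !linearN /= opprK.
by rewrite mderiv_mulX eqxx scale1r addrC addrK.
Qed.

Lemma even_compD_corr u c f :
  even_comp (u + c *: corr f) = even_comp u + (c * (s2 * n%:R)) *: f.
Proof. by rewrite addrC linearP /= even_comp_corr scalerA addrC. Qed.

Lemma Gamma_even w : Gamma w i0 = w i0 + even_comp (odd_comp w).
Proof.
rewrite /Gamma !ffunE !sum_ffunE -addrA; congr (_ + _).
rewrite addrC -scalerBr -sumrB; congr (_ *: _); apply: eq_bigr => i _.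
by rewrite !ffunE sum_Xm0 sum_Xp0.
Qed.

Lemma Gamma_odd w a : Gamma w (iodd a) = w (iodd a) - s2 *: corr (w i0) a.
Proof.
case: (split_ordP a) => j ->; rewrite ?corr_l ?corr_r.
all: rewrite /Gamma !ffunE !sum_ffunE -addrA -scaleNr -scalerN; congr (_ + _).
  rewrite (bigD1 j) //= big1 => [|i ij].
    rewrite big1 => [|i _]; rewrite !ffunE ?sum_Xp ?sum_Xm ?eqxx.
      by rewrite scale1r scaler0 !addr0 scalerN scaleNr.
    by rewrite eq_lrshift oppr0 scale0r.
  by rewrite !ffunE sum_Xp eq_lshift eq_sym (negPf ij) scale0r.
rewrite big1 => [|i _]; last by rewrite !ffunE sum_Xp eq_rlshift scale0r.
rewrite (bigD1 j) //= big1 => [|i ij].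
  by rewrite !ffunE sum_Xm eqxx scaleN1r addr0 scaler0 add0r.
by rewrite !ffunE sum_Xm eq_rshift eq_sym (negPf ij) oppr0 scale0r.
Qed.

(** As K (Gamma w) = w_0 + s E ([corr] w_0) = (1 + 2n) w_0, dividing the defect by 1 + 2n recovers
    the even component f, and adding s [corr] f back recovers the odd ones. *)
Definition Gamma_inv w : V :=
  let f := (1 + 2 * n%:R)^-1 *: defect w in
  glue f (odd_comp w + s2 *: corr f).

Lemma dim_neq0 : 1 + 2 * n%:R != 0 :> C.
Proof. by rewrite -natrM nat1r pnatr_eq0. Qed.

Lemma odd_comp_Gamma w : odd_comp (Gamma w) = odd_comp w - s2 *: corr (w i0).
Proof. by apply/ffunP=> a; rewrite [LHS]ffunE Gamma_odd !ffunE. Qed.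

Lemma odd_comp_glue f u : odd_comp (glue f u) = u.
Proof. by apply/ffunP=> a; rewrite ffunE glue_odd. Qed.

Lemma GammaK : cancel (@Gamma C n) Gamma_inv.
Proof.
move=> w; rewrite /Gamma_inv.
have -> : (1 + 2 * n%:R)^-1 *: defect (Gamma w) = w i0.
  rewrite /defect Gamma_even odd_comp_Gamma -[- (s2 *: corr _)]scaleNr
    even_compD_corr.
  rewrite opprD addrA addrK mulNr mulrA sqrt2_sqr scaleNr opprK.
  rewrite -{1}[w i0]scale1r -scalerDl scalerA mulVf ?scale1r //.
  exact: dim_neq0.
apply: eq_ptensor => [|a]; first by rewrite glue0.
by rewrite glue_odd odd_comp_Gamma subrK [LHS]ffunE.
Qed.

Lemma Gamma_invK : cancel Gamma_inv (@Gamma C n).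
Proof.
move=> w; rewrite /Gamma_inv; set f := _ *: defect w.
apply: eq_ptensor => [|a].
  rewrite Gamma_even glue0 odd_comp_glue even_compD_corr.
  rewrite mulrA sqrt2_sqr addrCA -[X in X + _ *: f]scale1r -scalerDl.
  by rewrite scalerA divff ?dim_neq0 // scale1r addrC subrK.
by rewrite Gamma_odd glue0 glue_odd !ffunE addrK.
Qed.

Lemma Gamma_tinc u : Gamma (tinc u) = glue (even_comp u) u.
Proof.
have tE : tinc u = glue 0 u by apply/ffunP.
apply: eq_ptensor => [|a].
  by rewrite Gamma_even tE !glue0 odd_comp_glue add0r.
rewrite Gamma_odd tE glue0 !glue_odd linear0.
by rewrite ffunE scaler0 subr0.
Qed.

Lemma defect0_Gamma w : defect w = 0 -> w = Gamma (tinc (odd_comp w)).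
Proof.
move/eqP; rewrite subr_eq0 => /eqP w0; rewrite Gamma_tinc.
by apply: eq_ptensor => [|a]; rewrite ?glue0 ?glue_odd ?ffunE.
Qed.

Lemma defect_Gamma u : defect (Gamma (tinc u)) = 0.
Proof. by rewrite Gamma_tinc /defect glue0 odd_comp_glue subrr. Qed.

End TensorAction.

(** * The tensor product with the oscillator representation *)

Section OscillatorAction.
Context {C : numClosedFieldType} {n : nat}.
Local Notation M := 'M[C]_(1 + (n + n)).
Local Notation P := {mpoly C[n]}.
Local Notation i0 := (lshift (n + n) (ord0 : 'I_1)).
Local Notation iodd := (@rshift 1 (n + n)).
Local Notation s2 := (sqrtC 2 : C).
Local Notation V := (ptensor C n (1 + (n + n))).
Local Notation U := (ptensor C n (n + n)).
Context {rho : M -> P -> P} (hrho : is_oscillator rho).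
Implicit Types (X Y : M) (a b : bool) (u : U) (w : V).

Lemma oscillator_rep : is_rep (@poly_par C n) rho.
Proof. by case: hrho. Qed.

Lemma oscillator_Xp j f : rho (Xp C j) f = s2^-1 *: mulX j f.
Proof. by case: hrho. Qed.

Lemma oscillator_Xm j f : rho (Xm C j) f = s2^-1 *: f^`M(j).
Proof. by case: hrho. Qed.

Lemma oscillator_linear X : osp X -> exists D : {linear P -> P}, rho X = D.
Proof.
by move=> Xo; apply: linear_structure; apply: (rep_linear oscillator_rep).
Qed.

Lemma ptensor_linE m c (w w' : ptensor C n m) i :
  (c *: w + w') i = c *: w i + w' i.
Proof. by rewrite !ffunE. Qed.

Lemma ptensor_subE m c (w w' : ptensor C n m) i :
  (w - c *: w') i = w i - c *: w' i.
Proof. by rewrite !ffunE. Qed.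

Lemma tens_repE X w i :
  tens_rep rho X w i = rho X (w i) +
    \sum_j (even_part X i j *: w j + odd_part X i j *: parity_sign (w j)).
Proof.
rewrite /tens_rep !ffunE -addrA big_split; congr (_ + _).
rewrite (bigD1 i) //= big1 => [|j ji]; first by rewrite mxE eqxx scale1r addr0.
by rewrite mxE eq_sym (negPf ji) scale0r.
Qed.

Lemma tens_rep_hom a X w i : mx_par a X ->
  tens_rep rho X w i = rho X (w i) + \sum_j X i j *: sgn_if a (w j).
Proof.
move=> Xa; rewrite tens_repE (even_part_par _ _ Xa) (odd_part_par _ _ Xa).
congr (_ + _); apply: eq_bigr => j _.
by case: (a); rewrite mxE scale0r ?addr0 ?add0r.
Qed.

Lemma tens_rep_linear X : osp X -> linear (tens_rep rho X).
Proof.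
move=> Xo c w w'; apply/ffunP=> i.
rewrite [RHS]ptensor_linE !tens_repE.
have [D rD] := oscillator_linear _ Xo; rewrite rD.
rewrite scalerDr addrACA scaler_sumr -big_split; congr (_ + _).
  by rewrite !ffunE linearP.
apply: eq_bigr => j _; rewrite ptensor_linE [parity_sign _]linearP /= !scalerDr.
by rewrite addrACA !scalerA ![c * _]mulrC.
Qed.

Lemma tens_rep_linear_osp X Y c w : osp X -> osp Y ->
  tens_rep rho (c *: X + Y) w = c *: tens_rep rho X w + tens_rep rho Y w.
Proof.
move=> Xo Yo; apply/ffunP=> i.
rewrite [RHS]ptensor_linE !tens_repE.
rewrite (rep_linear_osp oscillator_rep) // scalerDr addrACA scaler_sumr.
rewrite -big_split; congr (_ + _); apply: eq_bigr => j _.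
rewrite [even_part _]linearP [odd_part _]linearP /=.
by rewrite !mxE !scalerDl !scalerDr addrACA !scalerA.
Qed.

(** Each composite splits into a [rho] part, a matrix part and two mixed sums. Moving [rho] past the
    sign operator costs (-1)^(ab), so the mixed sums of the two orders cancel, and the other parts
    form brackets. *)
Lemma tens_rep_bracket a b X Y w :
  osp X -> osp Y -> mx_par a X -> mx_par b Y ->
  tens_rep rho (superbracket a b X Y) w
  = tens_rep rho X (tens_rep rho Y w)
    - (-1) ^+ (a && b) *: tens_rep rho Y (tens_rep rho X w).
Proof.
have comp a' b' X' Y' i : osp X' -> osp Y' -> mx_par a' X' -> mx_par b' Y' ->
    tens_rep rho X' (tens_rep rho Y' w) i =
    rho X' (rho Y' (w i))
    + (\sum_j Y' i j *: rho X' (sgn_if b' (w j))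
       + \sum_j X' i j *: sgn_if a' (rho Y' (w j)))
    + \sum_j (X' *m Y') i j *: sgn_if (a' (+) b') (w j).
  move=> Xo Yo Xa Yb; rewrite (tens_rep_hom _ _ _ _ Xa).
  rewrite (tens_rep_hom _ _ _ _ Yb).
  have [D rD] := oscillator_linear _ Xo; rewrite rD linearD -!addrA.
  congr (_ + _); rewrite linear_sum; congr (_ + _).
    by apply: eq_bigr => j _; rewrite linearZ.
  under eq_bigr => j _ do rewrite (tens_rep_hom _ _ _ _ Yb) linearD scalerDr.
  rewrite big_split /=; congr (_ + _).
  under eq_bigr => j _ do rewrite linear_sum scaler_sumr.
  rewrite exchange_big; apply: eq_bigr => k _ /=.
  rewrite mxE scaler_suml; apply: eq_bigr => j _.
  by rewrite linearZ /= sgn_ifD scalerA.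
move=> Xo Yo Xa Yb; apply/ffunP=> i.
have comm a' b' X' f : osp X' -> mx_par a' X' ->
    rho X' (sgn_if b' f) = (-1) ^+ (a' && b') *: sgn_if b' (rho X' f).
  move=> X'o X'a; have [D rD] := oscillator_linear _ X'o; rewrite rD.
  apply: linear_sgn_if => c g gc; rewrite -rD.
  exact: (rep_parity oscillator_rep).
have scaleC (c d : C) (f : P) : c *: (d *: f) = d *: (c *: f).
  by rewrite !scalerA mulrC.
have XYab := mx_par_superbracket _ _ _ _ Xa Yb.
rewrite (tens_rep_hom _ _ _ _ XYab) (rep_bracket oscillator_rep Xo Yo Xa Yb).
rewrite [RHS]ptensor_subE.
rewrite [X in _ = X - _](comp _ _ _ _ i Xo Yo Xa Yb).
rewrite [X in _ = _ - _ *: X](comp _ _ _ _ i Yo Xo Yb Xa).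
rewrite [b (+) a]addbC.
under [\sum_j Y i j *: _]eq_bigr => j _ do rewrite (comm a b) // scaleC.
under [\sum_j X i j *: rho Y _]eq_bigr => j _ do
  rewrite (comm b a) // andbC scaleC.
rewrite -!scaler_sumr !scalerDr !scalerA -expr2 sqrr_sign scale1r.
set c := (-1) ^+ (a && b).
have -> : \sum_j superbracket a b X Y i j *: sgn_if (a (+) b) (w j)
    = \sum_j (X *m Y) i j *: sgn_if (a (+) b) (w j)
      - c *: \sum_j (Y *m X) i j *: sgn_if (a (+) b) (w j).
  rewrite scaler_sumr -sumrB; apply: eq_bigr => j _.
  rewrite scalerA -scalerBl /superbracket.
  by congr (_ *: _); rewrite !mxE.
rewrite addrACA -opprD [X in _ - (_ + X + _)]addrC.
(* Here t is the total of the mixed sums, by now identical in both orders. *)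
have cancel_mid (p q r s t : P) : p + t + q - (r + t + s) = p + q - (r + s).
  by rewrite [p + t + q]addrAC [r + t + s]addrAC opprD addrACA subrr addr0.
by rewrite cancel_mid.
Qed.

Lemma tens_rep_Xp0 j w :
  tens_rep rho (Xp C j) w i0 =
  s2^-1 *: mulX j (w i0) + parity_sign (w (iodd (rshift n j))).
Proof.
by rewrite (tens_rep_hom _ _ _ _ (mx_par_Xp j)) oscillator_Xp sum_Xp0.
Qed.

Lemma tens_rep_Xm0 j w :
  tens_rep rho (Xm C j) w i0 =
  s2^-1 *: (w i0)^`M(j) + parity_sign (w (iodd (lshift n j))).
Proof.
by rewrite (tens_rep_hom _ _ _ _ (mx_par_Xm j)) oscillator_Xm sum_Xm0.
Qed.

Lemma tens_rep_Xp j w (a : 'I_(n + n)) :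
  tens_rep rho (Xp C j) w (iodd a) =
  s2^-1 *: mulX j (w (iodd a))
  + (a == lshift n j)%:R *: parity_sign (w i0).
Proof.
by rewrite (tens_rep_hom _ _ _ _ (mx_par_Xp j)) oscillator_Xp sum_Xp.
Qed.

Lemma tens_rep_Xm j w (a : 'I_(n + n)) :
  tens_rep rho (Xm C j) w (iodd a) =
  s2^-1 *: (w (iodd a))^`M(j)
  - (a == rshift n j)%:R *: parity_sign (w i0).
Proof.
by rewrite (tens_rep_hom _ _ _ _ (mx_par_Xm j)) oscillator_Xm sum_Xm scaleNr.
Qed.

(** * Stability of the kernel of K under osp(1|2n) *)

Lemma sqrt2_split : s2 = s2^-1 + s2^-1.
Proof.
by apply: (mulfI sqrt2_neq0); rewrite sqrt2_sqr mulrDr divff ?sqrt2_neq0.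
Qed.

(** Common core of [defect_Xp] and [defect_Xm], with L = x_j or d_j. The second hypothesis describes
    the i-th summand of E; summed over i, its delta term contributes s L w_0 + f to E w'. *)
Lemma defect_intertwine (L : {linear P -> P}) j f w w' :
  w' i0 = s2^-1 *: L (w i0) + f ->
  (forall i, mulX i (parity_sign (w' (iodd (lshift n i))))
             - (parity_sign (w' (iodd (rshift n i))))^`M(i)
    = - s2^-1 *: L (mulX i (parity_sign (w (iodd (lshift n i))))
                    - (parity_sign (w (iodd (rshift n i))))^`M(i))
      + (i == j)%:R *: (L (w i0) + s2^-1 *: f)) ->
  defect w' = - s2^-1 *: L (defect w).
Proof.
move=> w'0 w'o.
have -> : defect w' = w' i0
    - (- s2^-1 *: L (even_comp (odd_comp w)) + s2 *: (L (w i0) + s2^-1 *: f)).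
  congr (_ - _); rewrite [even_comp _ in RHS]/even_comp linearZ /=.
  rewrite scalerA mulrC -scalerA -scalerDr; congr (_ *: _).
  rewrite linear_sum scaler_sumr.
  under eq_bigr => i _ do rewrite !(ffunE _ (lshift n i)) !ffunE w'o.
  rewrite big_split /=; congr (_ + _).
    by apply: eq_bigr => i _; rewrite !ffunE.
  rewrite (bigD1 j) //= eqxx scale1r big1 ?addr0 // => i ij.
  by rewrite (negPf ij) scale0r.
rewrite w'0 /defect linearB /= scalerDr scalerA divff ?sqrt2_neq0 // scale1r.
(* The two copies of f cancel, and s^-1 - s = - s^-1 gives the coefficient of L w_0. *)
rewrite {3}sqrt2_split scalerDl scalerBr !scaleNr opprK.
set p := s2^-1 *: L (w i0); set q := s2^-1 *: L _.
by ring.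
Qed.

(** Here f = sigma w_{n+j}. In the delta term, x_j w_0 comes from T_j v_0 = v_j and s^-1 f from
    commuting d_i past x_j. *)
Lemma defect_Xp j w :
  defect (tens_rep rho (Xp C j) w) = - s2^-1 *: mulX j (defect w).
Proof.
apply: (defect_intertwine (mulX j) j) => [|i]; first exact: tens_rep_Xp0.
rewrite !tens_rep_Xp eq_rlshift scale0r addr0 eq_lshift.
set A := w _; set W := w _; set B := w (iodd (rshift n i)).
have -> c : parity_sign (s2^-1 *: mulX j A + c *: parity_sign W)
    = c *: W - s2^-1 *: mulX j (parity_sign A).
  by rewrite mulX_sign linearP linearZ /= parity_signK scalerN opprK addrC.
have -> : (parity_sign (s2^-1 *: mulX j B))^`M(i)
    = - (s2^-1 *: ((i == j)%:R *: parity_sign B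
                   + mulX j ((parity_sign B)^`M(i)))).
  rewrite -mderiv_mulX mulX_sign linearN scalerN opprK linearZ /=.
  by rewrite linearZ.
rewrite scaleNr; case: eqVneq => [{}ij|_].
  rewrite /B ij !scale1r -!mul_mpolyC /= /mulX; ring.
rewrite !scale0r -!mul_mpolyC /= /mulX; ring.
Qed.

(** Here f = sigma w_j. In the delta term, d_j w_0 comes from T_{-j} v_0 = - v_{n+j} and s^-1 f from
    commuting d_j past x_i. *)
Lemma defect_Xm j w :
  defect (tens_rep rho (Xm C j) w) = - s2^-1 *: (defect w)^`M(j).
Proof.
apply: (defect_intertwine (mderiv j) j) => [|i]; first exact: tens_rep_Xm0.
rewrite !tens_rep_Xm eq_lrshift scale0r subr0 eq_rshift.
set A := w _; set B := w _; set W := w i0.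
have -> c : (parity_sign (s2^-1 *: B^`M(j) - c *: parity_sign W))^`M(i)
    = - (c *: W^`M(i)) - s2^-1 *: ((parity_sign B)^`M(i))^`M(j).
  rewrite mderiv_comm [in RHS]mderiv_sign mderivN scalerN opprK.
  by rewrite linearB !linearZ /= parity_signK mderivD !mderivZ mderivN addrC.
have -> : parity_sign (s2^-1 *: A^`M(j)) = - (s2^-1 *: (parity_sign A)^`M(j)).
  by rewrite mderiv_sign linearZ /= scalerN opprK.
rewrite /= mderivB mderiv_mulX [j == i]eq_sym scaleNr.
case: eqVneq => [{}ij|_].
  rewrite /A ij !scale1r -!mul_mpolyC /= /mulX; ring.
rewrite !scale0r -!mul_mpolyC /= /mulX; ring.
Qed.

Lemma tens_rep0 w : tens_rep rho 0 w = 0.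
Proof.
have o0 := @osp0 C n; have := @tens_rep_linear_osp 0 0 (-1) w o0 o0.
by rewrite scaler0 addr0 scaleN1r addNr.
Qed.

Lemma defect_tens_rep X w : osp X -> defect w = 0 ->
  defect (tens_rep rho X w) = 0.
Proof.
(* The vector is generalized because the bracket case applies the hypothesis on X to Y w, and
   conversely. *)
move=> Xo; move: X Xo w.
apply: (osp_ind (fun X => forall w, defect w = 0 ->
  defect (tens_rep rho X w) = 0)).
- by move=> w _; rewrite tens_rep0 linear0.
- move=> c X Y Xo Yo IX IY w w0.
  by rewrite tens_rep_linear_osp // linearP /= IX // IY // scaler0 addr0.
- by move=> j w w0; rewrite defect_Xp w0 linear0 scaler0.
- by move=> j w w0; rewrite defect_Xm w0 linear0 scaler0.
move=> X Y Xo Yo Xa Yb IX IY w w0.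
rewrite (tens_rep_bracket true true) // -scaleNr addrC linearP /=.
have [IYX IXY] := (IY _ (IX _ w0), IX _ (IY _ w0)).
by rewrite [X in _ *: X]IYX [X in _ + X]IXY scaler0 addr0.
Qed.

(** * The transported action on polynomials with values in C^{0|2n} *)

Definition osc_act X u : U := odd_comp (tens_rep rho X (Gamma (tinc u))).

(** Taking odd components undoes Gamma on the kernel of K, and X maps that kernel into itself. *)
Lemma Gamma_osc_act X u : osp X ->
  Gamma (tinc (osc_act X u)) = tens_rep rho X (Gamma (tinc u)).
Proof.
move=> Xo; rewrite -defect0_Gamma //; apply: defect_tens_rep => //.
exact: defect_Gamma.
Qed.

Lemma Gamma_tinc_linear c u u' :
  Gamma (tinc (c *: u + u')) = c *: Gamma (tinc u) + Gamma (tinc u').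
Proof.
rewrite !Gamma_tinc; apply: eq_ptensor => [|a]; rewrite ptensor_linE.
  by rewrite !glue0 linearP.
by rewrite !glue_odd ptensor_linE.
Qed.

(** The components of u have parity b + 1 and E u has parity b; since v_0 is even, the pair (E u, u)
    is homogeneous of parity b, which X shifts by a. *)
Lemma osc_act_par a b X u : osp X -> mx_par a X -> odd_tens_par b u ->
  odd_tens_par (a (+) b) (osc_act X u).
Proof.
move=> Xo Xa ub i; rewrite ffunE (tens_rep_hom _ _ _ _ Xa) Gamma_tinc glue_odd.
apply: poly_parD.
  rewrite -addbN; apply: (rep_parity oscillator_rep) => //; exact: ub.
have := even_comp_par _ _ ub; set f := even_comp u => fb.
case: a Xa => -> /=.
  by rewrite sum_odd_block glue0 negbK; apply/poly_parZ/poly_par_sign.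
rewrite big_split_ord /= big_ord1 block_mxEdl mxE scale0r add0r.
apply: poly_par_sum => k _; rewrite glue_odd; apply: poly_parZ; exact: ub.
Qed.

Lemma osc_act_rep : is_rep (@odd_tens_par C n) osc_act.
Proof.
split.
- move=> X Xo c u u'; rewrite /osc_act Gamma_tinc_linear.
  by rewrite tens_rep_linear // linearP.
- move=> X Y Xo Yo c u; rewrite /osc_act.
  by rewrite tens_rep_linear_osp // linearP.
- exact: osc_act_par.
move=> a b X Y Xo Yo Xa Yb u.
(* Nested tensor actions become Gamma images of iterated [osc_act], whose odd components can be read
   off. *)
rewrite {1}/osc_act (tens_rep_bracket a b) // -!Gamma_osc_act //.
move: (osc_act X (osc_act Y u)) (osc_act Y (osc_act X u)) => v v'.
rewrite !Gamma_tinc; apply/ffunP=> i.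
by rewrite ffunE !ptensor_subE !glue_odd.
Qed.

Lemma osc_act_Xp j u :
  osc_act (Xp C j) u = s2^-1 *: [ffun a => mulX j (u a)]
    + tens (parity_sign (even_comp u)) (odd_v C j).
Proof.
apply/ffunP=> a; rewrite ffunE tens_rep_Xp Gamma_tinc glue0 glue_odd !ffunE.
by rewrite mxE eqxx andbT.
Qed.

Lemma osc_act_Xm j u :
  osc_act (Xm C j) u = s2^-1 *: [ffun a => (u a)^`M(j)]
    - tens (parity_sign (even_comp u)) (odd_vn C j).
Proof.
apply/ffunP=> a; rewrite ffunE tens_rep_Xm Gamma_tinc glue0 glue_odd !ffunE.
by rewrite mxE eqxx andbT.
Qed.

(** This value and the next supply the terms with coefficient sqrt 2 in [action_formulas]. *)
Lemma parity_sign_even_comp_v (f : P) i :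
  parity_sign (even_comp (tens f (odd_v C i))) = - s2 *: mulX i f.
Proof.
rewrite parity_sign_even_comp scaleNr -scalerN; congr (_ *: _).
rewrite (bigD1 i) //= big1 => [|k ki];
  rewrite !ffunE !mxE ?eq_lshift ?eq_rlshift.
  by rewrite !eqxx scale1r scale0r linear0 add0r addr0.
by rewrite (negPf ki) !scale0r !linear0 ?subr0 ?addr0.
Qed.

Lemma parity_sign_even_comp_vn (f : P) i :
  parity_sign (even_comp (tens f (odd_vn C i))) = s2 *: f^`M(i).
Proof.
rewrite parity_sign_even_comp; congr (_ *: _).
rewrite (bigD1 i) //= big1 => [|k ki];
  rewrite !ffunE !mxE ?eq_rshift ?eq_lrshift.
  by rewrite !eqxx scale1r scale0r linear0 ?subr0 !addr0.
by rewrite (negPf ki) !scale0r !linear0 ?subr0 ?addr0.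
Qed.

Lemma tensZl m c (f : P) (v : 'cV[C]_m) : tens (c *: f) v = c *: tens f v.
Proof. by apply/ffunP=> a; rewrite !ffunE !scalerA mulrC. Qed.

Lemma mulX_tens m j (f : P) (v : 'cV[C]_m) :
  [ffun a => mulX j (tens f v a)] = tens (mulX j f) v.
Proof. by apply/ffunP=> a; rewrite !ffunE linearZ. Qed.

Lemma mderiv_tens m j (f : P) (v : 'cV[C]_m) :
  [ffun a => (tens f v a)^`M(j)] = tens (f^`M(j)) v.
Proof. by apply/ffunP=> a; rewrite !ffunE linearZ. Qed.

Lemma mulX_mpolyX j k : mulX j 'X_[k] = 'X_[k + U_(j)] :> P.
Proof. by rewrite /mulX -mpolyXD addmC. Qed.

Lemma osc_act_formulas : action_formulas osc_act.
Proof.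
move=> i j k; split.
- rewrite osc_act_Xp parity_sign_even_comp_v mulX_tens !mulX_mpolyX.
  by rewrite tensZl scaleNr.
- rewrite osc_act_Xp parity_sign_even_comp_vn mulX_tens mulX_mpolyX mderivX.
  by rewrite scalerA tensZl.
- rewrite osc_act_Xm parity_sign_even_comp_v mderiv_tens mulX_mpolyX mderivX.
  by rewrite !tensZl scaleNr opprK scalerA.
- rewrite osc_act_Xm parity_sign_even_comp_vn mderiv_tens !mderivX.
  by rewrite scalerA !tensZl scalerA.
Qed.

End OscillatorAction.

(** * Uniqueness of a representation satisfying the formulas *)

Section Uniqueness.
Context {C : numClosedFieldType} {n : nat}.
Local Notation M := 'M[C]_(1 + (n + n)).
Local Notation U := (ptensor C n (n + n)).

Lemma eq_linear_tens (V : lmodType C) (D E : {linear U -> V}) :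
  (forall k i, D (tens 'X_[k] (odd_v C i)) = E (tens 'X_[k] (odd_v C i))) ->
  (forall k i, D (tens 'X_[k] (odd_vn C i)) = E (tens 'X_[k] (odd_vn C i))) ->
  D =1 E.
Proof.
move=> DEv DEvn u.
(* Every coordinate is expanded in monomials, so that u becomes a combination of monomials tensored
   with basis vectors. *)
have -> : u = \sum_a \sum_(k <- msupp (u a))
    (u a)@_k *: tens 'X_[k] (delta_mx a 0 : 'cV[C]_(n + n)).
  apply/ffunP=> b; rewrite sum_ffunE (bigD1 b) //= [X in _ + X]big1 => [|a ab].
    rewrite sum_ffunE addr0 {1}(mpolyE (u b)); apply: eq_bigr => k _.
    by rewrite !ffunE mxE !eqxx scale1r.
  rewrite sum_ffunE big1 // => k _.
  by rewrite !ffunE mxE eq_sym (negPf ab) scale0r scaler0.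
rewrite !linear_sum; apply: eq_bigr => a _.
rewrite !linear_sum; apply: eq_bigr => k _.
rewrite !linearZ /=; congr (_ *: _).
by case: (split_ordP a) => i ->; [apply: DEv|apply: DEvn].
Qed.

(** The formulas fix the generators on a spanning family, hence everywhere by linearity; [osp_ind]
    carries the agreement to all of osp(1|2n) through linear combinations and brackets. *)
Lemma rep_unique (par par' : bool -> U -> Prop) (phi psi : M -> U -> U) :
  is_rep par phi -> is_rep par' psi ->
  action_formulas phi -> action_formulas psi ->
  forall X u, osp X -> phi X u = psi X u.
Proof.
move=> phiR psiR phiF psiF X u Xo; move: X Xo u.
have lin X : osp X ->
    (forall k i, phi X (tens 'X_[k] (odd_v C i))
      = psi X (tens 'X_[k] (odd_v C i))) ->
    (forall k i, phi X (tens 'X_[k] (odd_vn C i))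
      = psi X (tens 'X_[k] (odd_vn C i))) ->
    forall u, phi X u = psi X u.
  move=> Xo.
  have [D ->] := linear_structure _ _ _ _ (rep_linear phiR Xo).
  have [E ->] := linear_structure _ _ _ _ (rep_linear psiR Xo).
  exact: eq_linear_tens.
have rep0 par0 chi u : is_rep par0 chi -> chi (0 : M) u = 0 :> U.
  move=> chiR; have o0 := @osp0 C n; have := rep_linear_osp chiR o0 o0 (-1) u.
  by rewrite scaler0 addr0 scaleN1r addNr.
apply: (osp_ind (fun X => forall u, phi X u = psi X u)).
- by move=> u; rewrite (rep0 par) ?(rep0 par').
- move=> c X Y Xo Yo IX IY u.
  by rewrite (rep_linear_osp phiR) // (rep_linear_osp psiR) // IX IY.
- move=> j; apply: lin; first exact: osp_Xp.
    by move=> k i; case: (phiF i j k) (psiF i j k) => -> _ _ _ [->].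
  by move=> k i; case: (phiF i j k) (psiF i j k) => _ -> _ _ [_ ->].
- move=> j; apply: lin; first exact: osp_Xm.
    by move=> k i; case: (phiF i j k) (psiF i j k) => _ _ -> _ [_ _ ->].
  by move=> k i; case: (phiF i j k) (psiF i j k) => _ _ _ -> [_ _ _ ->].
move=> X Y Xo Yo Xa Yb IX IY u.
by rewrite (rep_bracket phiR Xo Yo Xa Yb) (rep_bracket psiR Xo Yo Xa Yb)
  !IX !IY.
Qed.

End Uniqueness.

Theorem corollary1p5 (R : realType) (n : nat) (hn : (1 <= n)%N)
    (rho : 'M[R[i]]_(1 + (n + n)) -> {mpoly R[i][n]} -> {mpoly R[i][n]})
    (hrho : is_oscillator rho) :
  exists Gamma_inv : ptensor R[i] n (1 + (n + n)) -> ptensor R[i] n (1 + (n + n)),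
  [/\ cancel (@Gamma R[i] n) Gamma_inv, cancel Gamma_inv (@Gamma R[i] n) &
  exists act : 'M[R[i]]_(1 + (n + n)) ->
      ptensor R[i] n (n + n) -> ptensor R[i] n (n + n),
  [/\ forall X u, osp X ->
        tinc (act X u) = Gamma_inv (tens_rep rho X (Gamma (tinc u))),
      is_rep (@odd_tens_par R[i] n) act,
      action_formulas act &
      forall act' : 'M[R[i]]_(1 + (n + n)) ->
          ptensor R[i] n (n + n) -> ptensor R[i] n (n + n),
        is_rep (@odd_tens_par R[i] n) act' -> action_formulas act' ->
        forall X u, osp X -> act' X u = act X u]].
Proof.
exists Gamma_inv; split; [exact: GammaK | exact: Gamma_invK |].
exists (osc_act (rho := rho)); split.
(* The tensor action on Gamma u is itself a Gamma image, so [Gamma_inv] cancels against it. *)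
- by move=> X u Xo; rewrite -(Gamma_osc_act hrho) // GammaK.
- exact: osc_act_rep.
- exact: osc_act_formulas.
move=> act act_rep act_formulas X u Xo.
exact: (rep_unique _ _ _ _ act_rep (osc_act_rep hrho) act_formulas
  (osc_act_formulas hrho)).
Qed.
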